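(* Each $\Sigma$-space with a countable locally uniform $\overline{\mathsf{cs}}^{**}$-netbase is a $\sigma$-space.
   Context: Regular means: every neighborhood of each point contains a closed neighborhood of that point. A family $\mathcal F$ of subsets of $X$ is discrete if each point of $X$ has a neighborhood meeting at most one member of $\mathcal F$; it is $\sigma$-discrete if it is a countable union of discrete families. A family $\mathcal N$ of subsets is a network if for any open $U\subset X$ and $x\in U$ there is $N\in\mathcal N$ with $x\in N\subset U$. For a family $\mathcal C$ of subsets, $\mathcal N$ is a $\mathcal C$-network if for every $C\in\mathcal C$ and open $U\supset C$ there is $N\in\mathcal N$ with $C\subset N\subset U$. A $\sigma$-space is a regular $T_0$-space with a $\sigma$-discrete network. A $\Sigma$-space is a regular $T_0$-space that has a $\sigma$-discrete $\mathcal C$-network for some cover $\mathcal C$ of the space by closed countably compact subspaces. A set $C\subset X$ accumulates at $x$ if every neighborhood of $x$ contains infinitely many points of $C$. A closed set is countably compact if each of its infinite subsets accumulates at some point. $\overline{\mathsf{cs}}$ is the family of all countable subsets of $X$ with countably compact closure in $X$. An entourage on $X$ is a subset $E\subset X\times X$ containing the diagonal; $E[x]=\{y:(x,y)\in E\}$, $E^{-1}=\{(y,x):(x,y)\in E\}$, $UV=\{(x,z):\exists y\ (x,y)\in U,\ (y,z)\in V\}$. An entourage base for $X$ is a family $\mathcal B$ of entourages such that (i) for all $B_1,B_2\in\mathcal B$ there is $B_3\in\mathcal B$ with $B_3\subset B_1\cap B_2$; (ii) for every $x\in X$ the family $\{B[x]:B\in\mathcal B\}$ is a neighborhood base at $x$.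 It is locally uniform if for every $x\in X$ and neighborhood $O_x$ of $x$ there is $B\in\mathcal B$ with $BB^{-1}B[x]\subset O_x$. A $\mathcal C^{**}$-netbase for $X$ is a pair $(\mathcal E,\mathcal B)$ with $\mathcal E$ a family of entourages on $X$ and $\mathcal B$ an entourage base for $X$ such that for any $B\in\mathcal B$ and any $C\in\mathcal C$ accumulating at some point of $X$ there are $E\in\mathcal E$, $E\subset B$, and $z\in X$ with $E[z]\cap C$ infinite. It is countable if $\mathcal E$ is countable and locally uniform if $\mathcal B$ is. *)

(* Defs.v *)
From mathcomp Require Import all_boot all_order all_classical topology.

Set Implicit Arguments.
Unset Strict Implicit.
Unset Printing Implicit Defensive.

Local Open Scope classical_set_scope.
Local Open Scope relation_scope.

Definition discrete_family (X : topologicalType) (F : set (set X)) : Prop :=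
  forall x : X, exists2 V : set X, nbhs x V &
    forall A B : set X, F A -> F B ->
      A `&` V !=set0 -> B `&` V !=set0 -> A = B.

Definition sigma_discrete (X : topologicalType) (F : set (set X)) : Prop :=
  exists2 D : nat -> set (set X),
    (forall n, discrete_family (D n)) & F = \bigcup_n D n.

Definition network (X : topologicalType) (N : set (set X)) : Prop :=
  forall (U : set X) (x : X), open U -> U x ->
    exists A : set X, [/\ N A, A x & A `<=` U].

Definition cover_network (X : topologicalType) (C N : set (set X)) : Prop :=
  forall K U : set X, C K -> open U -> K `<=` U ->
    exists A : set X, [/\ N A, K `<=` A & A `<=` U].

Definition accumulation_at (X : topologicalType) (A : set X) (x : X) : Prop :=
  forall V : set X, nbhs x V -> infinite_set (V `&` A).

(* The accumulation point is sought in [X]; it lies in [K] as [K] is closed. *)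
Definition closed_countably_compact (X : topologicalType) (K : set X) : Prop :=
  closed K /\
  forall A : set X, A `<=` K -> infinite_set A -> exists x : X, accumulation_at A x.

Definition sigma_space (X : topologicalType) : Prop :=
  [/\ regular_space X, kolmogorov_space X &
      exists N : set (set X), sigma_discrete N /\ network N].

Definition Sigma_space (X : topologicalType) : Prop :=
  [/\ regular_space X, kolmogorov_space X &
      exists C N : set (set X),
        [/\ \bigcup_(K in C) K = [set: X],
            forall K : set X, C K -> closed_countably_compact K,
            sigma_discrete N & cover_network C N]].

Definition cs_bar (X : topologicalType) : set (set X) :=
  [set A | countable A /\ closed_countably_compact (closure A)].

(* Not the library's [entourage]: [X] carries no uniform structure. *)
Definition is_entourage (X : Type) (E : set (X * X)) : Prop := diagonal `<=` E.

(* [xsection B x] is the ball B[x] = {y | (x, y) in B}. *)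
Definition entourage_base (X : topologicalType) (B : set (set (X * X))) : Prop :=
  [/\ forall E : set (X * X), B E -> is_entourage E,
      forall B1 B2 : set (X * X), B B1 -> B B2 ->
        exists2 B3 : set (X * X), B B3 & B3 `<=` B1 `&` B2 &
      forall x : X,
        (forall B1 : set (X * X), B B1 -> nbhs x (xsection B1 x)) /\
        (forall V : set X, nbhs x V ->
           exists2 B1 : set (X * X), B B1 & xsection B1 x `<=` V)].

Definition locally_uniform (X : topologicalType) (B : set (set (X * X))) : Prop :=
  forall (x : X) (V : set X), nbhs x V ->
    exists2 B1 : set (X * X), B B1 & xsection (B1 \; B1^-1 \; B1) x `<=` V.

Definition netbase (X : topologicalType) (C : set (set X))
    (E B : set (set (X * X))) : Prop :=
  [/\ forall E1 : set (X * X), E E1 -> is_entourage E1,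
      entourage_base B &
      forall (B1 : set (X * X)) (A : set X), B B1 -> C A ->
        (exists x : X, accumulation_at A x) ->
        exists E1 : set (X * X), [/\ E E1, E1 `<=` B1 &
          exists z : X, infinite_set (xsection E1 z `&` A)]].

(* Main.v *)
Require Import Defs.
From mathcomp Require Import all_boot all_order all_classical topology.

(** Fix an enumeration [f] of the countable family of entourages.  For a finite
set [e] of indices call [x] and [y] linked when some [f j] with [j] in [e] has
a ball containing both (or [x = y]), and call a set small when any two of its
points are linked to a common third.

Totally bounded sets.  Let [T n] be sets such that every injective sequence
with [x n] in [T n] has countably compact closure.  Then for each base entourage [B1] some [T n] is covered by countably many sets that are small for
some [e] all of whose entourages lie in [B1] ([linked_covered]).  Otherwise a
sequence could be chosen greedily so that [x n] is not linked, by the first [n]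
admissible entourages, to any earlier term; but the netbase yields an
admissible [f j] and a ball of it containing infinitely many terms, hence two
linked terms of index above [j].

Small sets are small.  Local uniformity, used twice, shows that near [x] the
small sets through [x], for fine enough [e], lie inside a given neighbourhood
of [x] ([linked_small_sub]).  So wherever a set can be covered as above for
every [B1], the chosen covers, indexed by the countably many [e], contain a
network.

From one compactum to the whole space.  With [T n] equal to a member [K] of the
cover [C], the traces on [K] of a countable family form a network of [K], so
[K] is Lindelof, hence compact, hence has a closed neighbourhood inside each
open set around it ([netbase_ccpt_shrink]).  Therefore the closures of the
members of the [C]-network are again a [C]-network.  Now let [T n] be the
intersection of those closures, taken from the first [n] discrete families,
that contain [K].  The sets [T n] are closed and shrink to [K], which makes
every sequence with [x n] in [T n] have countably compact closure
([ccpt_closure_range]).  So some [T n] is covered by small sets.  Each discrete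
family contributes at most one member containing [K], so the sets [T n] belong
to a sigma-discrete family that does not depend on [K]; cutting its members
into their countably many small pieces keeps it sigma-discrete and makes it a
network. *)

Set Implicit Arguments.
Unset Strict Implicit.
Unset Printing Implicit Defensive.

Local Open Scope classical_set_scope.
Local Open Scope relation_scope.

(** * Sequences and countability *)

Lemma greedy_sequence (X : Type) (P : seq X -> X -> Prop) :
  (forall s, exists y, P s y) -> exists x : nat -> X, forall n, P (mkseq x n) (x n).
Proof.
move=> /choice[next nextP].
pose hist n := iter n (fun s => rcons s (next s)) [::].
exists (next \o hist) => n.
suff -> : mkseq (next \o hist) n = hist n by exact: nextP.
by elim: n => // n IHn; rewrite /mkseq -addn1 iotaD map_cat -/(mkseq _ n) IHn cats1 addn1.
Qed.

Lemma infinite_range (X : Type) (x : nat -> X) :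
  (forall n, finite_set [set m | x m = x n]) -> infinite_set (range x).
Proof.
move=> fin_fibre fin_x; apply: infinite_nat.
rewrite (_ : [set: nat] = \bigcup_(a in range x) (x @^-1` [set a])).
  by apply: bigcup_finite => // _ [n _ <-]; exact: fin_fibre.
by apply/seteqP; split=> // n _; exists (x n).
Qed.

Lemma infinite_range_inj (X : Type) (x : nat -> X) :
  injective x -> infinite_set (range x).
Proof.
move=> xI; apply: infinite_range => n.
by apply: sub_finite_set (finite_set1 n) => m /= /xI ->.
Qed.

Lemma countable_enum (T : Type) (A : set (set T)) :
  countable A -> exists f : nat -> set T, forall S, A S -> exists n, f n = S.
Proof.
move=> /countable_injP[g gI].
exists (fun n => [set p | exists S, [/\ A S, g S = n & S p]]) => S AS.
exists (g S); apply/seteqP; split=> [p [S' [AS' gS' Sp]]|p Sp]; last by exists S.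
by rewrite -(gI _ _ _ _ gS') ?inE.
Qed.

(** * Regular and countably compact sets *)

Section Topology.
Variable X : topologicalType.
Implicit Types (A K U : set X) (x y : X).

Lemma regular_nbhs x U : regular_space X -> nbhs x U ->
  exists V, [/\ open V, V x & closure V `<=` U].
Proof.
move=> /(_ x) /[apply] -[V]; rewrite nbhsE => -[W [oW Wx] WV] VU.
by exists W; split=> //; apply: subset_trans VU; exact: closureS.
Qed.

Lemma regular_T0_accessible :
  regular_space X -> kolmogorov_space X -> accessible_space X.
Proof.
move=> regX T0 x y /T0[A [] []]; rewrite !inE => Ax nAy.
  by move: Ax; rewrite nbhsE => -[V [oV Vx] VA]; exists V; split; rewrite ?inE //= => /VA.
have [V [oV Vy VA]] := regular_nbhs regX Ax.
exists (~` closure V); split; rewrite ?inE //=.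
- exact/closed_openC/closed_closure.
- by move=> /VA.
- by apply; exact: subset_closure.
Qed.

Lemma ccpt_sub K A : closed_countably_compact K -> closed A -> A `<=` K ->
  closed_countably_compact A.
Proof. by move=> [_ accK] clA AK; split=> // S SA; apply: accK => y /SA /AK. Qed.

Lemma ccpt_closure_sub K A : closed_countably_compact K -> A `<=` K ->
  closed_countably_compact (closure A).
Proof.
move=> Kc AK; apply: (ccpt_sub Kc); first exact: closed_closure.
by case: Kc => /closure_id -> _; exact: closureS.
Qed.

(** A point has a neighbourhood meeting [A] in a finite set, which is closed in
a T1 space and can be cut out. *)
Lemma nonaccumulating_closed A : accessible_space X ->
  ~ (exists x, accumulation_at A x) -> closed A.
Proof.
move=> /accessible_finite_set_closed T1 accA; rewrite -openC openE => x /= nAx.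
have [V [Vx /contrapT finV]] : exists V, nbhs x V /\ ~ infinite_set (V `&` A).
  apply: contrapT => nV; apply: accA; exists x => V Vx.
  by apply: contrapT => finV; apply: nV; exists V.
have : nbhs x (V `&` ~` (V `&` A)).
  apply: filterI => //; apply: open_nbhs_nbhs; split; last by move=> [].
  by apply: closed_openC; exact: T1.
by apply: filterS => y [Vy nVAy] Ay; apply: nVAy.
Qed.

(** If no finite subfamily covers [K], pick [x n] in [K] outside the first [n]
sets.  An accumulation point lies in some [O m], which then contains infinitely
many points of the sequence, although [x n] avoids [O m] once [m < n]. *)
Lemma ccpt_countable_cover K (O : nat -> set X) : closed_countably_compact K ->
  (forall n, open (O n)) -> K `<=` \bigcup_n O n ->
  exists n, K `<=` \bigcup_(m < n) O m.
Proof.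
move=> [clK accK] oO KO; apply: contrapT => nfin.
have /choice[x xP] n : exists x, K x /\ forall m, (m < n)%N -> ~ O m x.
  apply: contrapT => nx; apply: nfin; exists n => y Ky.
  apply: contrapT => nOy; apply: nx; exists y; split=> // m mn Omy.
  by apply: nOy; exists m.
(* No value is taken infinitely often, since each lies in some [O m]. *)
have fibre n m : O m (x n) -> (n <= m)%N.
  by move=> Omx; rewrite leqNgt; apply/negP => /(xP n).2.
have xinf : infinite_set (range x).
  apply: infinite_range => n; have [m _ Om] := KO _ (xP n).1.
  by apply: sub_finite_set (finite_II m.+1) => k /= xk; rewrite ltnS; apply: fibre; rewrite xk.
have [|y accy] := accK (range x) _ xinf.
  by move=> _ [n _ <-]; exact: (xP n).1.
have Ky : K y.
  apply: clK => V /accy/infinite_setN0[z [Vz [n _ xnz]]]; exists z; split=> //.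
  by rewrite -xnz; exact: (xP n).1.
have [m _ Omy] := KO _ Ky.
have /accy : nbhs y (O m) by apply: open_nbhs_nbhs; split.
apply; apply: sub_finite_set (finite_image x (finite_II m.+1)).
move=> _ [/[swap] [[n _ <-]] Omx]; exists n => //=; rewrite ltnS; exact: fibre.
Qed.

(** The sets [Q m] need not lie in [K]: only the points of [K] are tested.  Each
[Q m] that fits in an open set whose closure is inside [U] is enlarged to such
a set.  This gives a countable cover of [K], and finitely many of its members
suffice. *)
Lemma ccpt_trace_network_shrink K U (Q : nat -> set X) : regular_space X ->
  closed_countably_compact K ->
  (forall x V, K x -> nbhs x V -> exists m, Q m x /\ Q m `<=` V) ->
  open U -> K `<=` U -> exists V, [/\ open V, K `<=` V & closure V `<=` U].
Proof.
move=> regX Kc QP oU KU.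
have /choice[O OP] m : exists O, [/\ open O, closure O `<=` U &
    (exists W, [/\ open W, closure W `<=` U & Q m `<=` W]) -> Q m `<=` O].
  have [[W [oW WU QW]]|nW] := pselect (exists W, [/\ open W, closure W `<=` U & Q m `<=` W]).
    by exists W.
  by exists set0; split=> //; [exact: open0|rewrite closure0].
have [m|x Kx|n Kn] := @ccpt_countable_cover K O Kc; first by have [] := OP m.
  have [|V [oV Vx VU]] := @regular_nbhs x U regX.
    by apply: open_nbhs_nbhs; split=> //; exact: KU.
  have [|m [Qx QV]] := QP x V Kx; first by apply: open_nbhs_nbhs; split.
  by exists m => //; have [_ _] := OP m; apply=> //; exists V; split.
exists (\bigcup_(m < n) O m); split=> //.
  by apply: bigcup_open => m _; have [] := OP m.
apply: (@subset_trans _ (\bigcup_(m < n) closure (O m))); last first.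
  by move=> y [m _]; have [_ OU _] := OP m; exact: OU.
have /closure_id -> : closed (\bigcup_(m < n) closure (O m)).
  by apply: closed_bigcup => // m _; exact: closed_closure.
by apply: closureS => y [m mn Oy]; exists m => //; exact: subset_closure.
Qed.

End Topology.

(** * Sets small for finitely many entourages *)

Section LinkedSets.
Variables (X : topologicalType) (f : nat -> set (X * X)).
Implicit Types (e : seq nat) (S T : set X).

(** This is the union, over [j] in [e], of the compositions of the inverse of
[f j] with [f j].  The first alternative makes the relation reflexive for every
[e], the empty one included. *)
Definition linked e : set (X * X) :=
  [set p | p.1 = p.2 \/ exists j z, [/\ j \in e, f j (z, p.1) & f j (z, p.2)]].

(** The balls of [linked e] are small, with [c] their centre.  Locating a small
set inside a neighbourhood involves two of its points at a time, so [c] may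
vary with the pair. *)
Definition linked_small e S :=
  forall x y, S x -> S y -> exists2 c, linked e (c, x) & linked e (c, y).

Definition linked_cover e T (P : nat -> set X) :=
  (forall k, linked_small e (P k)) /\ T `<=` \bigcup_k P k.

(** Choosing the covers once and for all, for each set and each [e], is what
makes the pieces of a discrete family discrete: a set has one [k]-th piece. *)
Lemma linked_covers : exists P : set X -> seq nat -> nat -> set X,
  forall T e, (forall k, linked_small e (P T e k)) /\
    ((exists Q, linked_cover e T Q) -> linked_cover e T (P T e)).
Proof.
have [|P PP] := @choice (set X * seq nat) (nat -> set X) (fun Te P =>
    (forall k, linked_small Te.2 (P k)) /\
    ((exists Q, linked_cover Te.2 Te.1 Q) -> linked_cover Te.2 Te.1 P)); last first.
  by exists (fun T e => P (T, e)) => T e; exact: (PP (T, e)).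
move=> [T e] /=; have [[Q QT]|nQ] := pselect (exists Q, linked_cover e T Q).
  by exists Q; split=> //; case: QT.
by exists (fun=> set0); split=> [k x y []|/nQ].
Qed.

Variables (E B : set (set (X * X))).
Hypotheses (fE : forall D, E D -> exists n, f n = D) (EB : netbase (@cs_bar X) E B).

(** A greedy choice of points pairwise unlinked would contradict the defining
property of the netbase. *)
Lemma linked_covered (T : nat -> set X) (B1 : set (X * X)) : B B1 ->
  (forall x : nat -> X, injective x -> (forall n, T n (x n)) ->
     closed_countably_compact (closure (range x))) ->
  exists n e, (forall j, j \in e -> f j `<=` B1) /\
    exists P, linked_cover e (T n) P.
Proof.
move=> BB1 trap; apply: contrapT => ncov.
(* The admissible indices below [n]. *)
pose inB n := [seq j <- iota 0 n | `[< f j `<=` B1 >]].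
have [s|x xP] := @greedy_sequence X (fun s y => T (size s) y /\
    forall c, c \in s -> ~ linked (inB (size s)) (c, y)).
  apply: contrapT => ny; apply: ncov; exists (size s), (inB (size s)); split.
    by move=> j; rewrite mem_filter => /andP[/asboolP].
  exists (fun k => [set y | exists2 c, onth s k = Some c & linked (inB (size s)) (c, y)]).
  split=> [k y z /= [c -> cy] [_ [<-] cz]|y Ty]; first by exists c.
  apply: contrapT => nyP; apply: ny; exists y; split=> // c /onthP[k sk] cy.
  by apply: nyP; exists k => //; exists c.
have xT n : T n (x n) by have [] := xP n; rewrite size_mkseq.
have xsep m n : (m < n)%N -> ~ linked (inB n) (x m, x n).
  move=> mn; have [_] := xP n; rewrite size_mkseq; apply.
  by apply/mapP; exists m; rewrite ?mem_iota.
have xI : injective x.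
  move=> m n xmn; have [mn|nm|//] := ltngtP m n.
    by case: (xsep _ _ mn); left; rewrite /= xmn.
  by case: (xsep _ _ nm); left; rewrite /= xmn.
have xcpt := trap x xI xT; have xinf := infinite_range_inj xI.
have [_ _ /(_ B1 (range x) BB1)[]] := EB.
- by split=> //; apply: sub_countable (card_image_le _ _) _.
- by case: xcpt => _; apply=> //; exact: subset_closure.
move=> _ [] /fE[j <-] fB [z]; apply.
(* Two indices in [I] above [j] would be linked by [f j], against [xsep]. *)
pose I := [set n | f j (z, x n)].
suff finI : finite_set I.
  apply: sub_finite_set (finite_image x finI) => _ [/[swap] [[n _ <-]] /xsectionP fn].
  by exists n.
have [[m [jm fm]]|nI] := pselect (exists m, (j < m)%N /\ I m).
  apply: sub_finite_set (finite_II m.+1) => n fn /=.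
  rewrite ltnS leqNgt; apply/negP => mn; apply: (xsep m n mn); right.
  exists j, z; split=> //; rewrite mem_filter mem_iota /= (ltn_trans jm mn) andbT.
  exact/asboolP.
apply: sub_finite_set (finite_II j.+1) => n fn /=.
by rewrite ltnS leqNgt; apply/negP => jn; apply: nI; exists n.
Qed.

Hypothesis BU : locally_uniform B.

(** If [S] is small and contains [x] and [y], then [y] is reached from [x] in
four half-steps through the common link [c].  The first two are absorbed in a
single step of [B1] by applying local uniformity to the neighbourhood
[xsection B1 x]; the remaining three steps are those of local uniformity for
[V]. *)
Lemma linked_small_sub x (V : set X) : nbhs x V ->
  exists2 B1, B B1 & forall e S, (forall j, j \in e -> f j `<=` B1) ->
    linked_small e S -> S x -> S `<=` V.
Proof.
have [_ [Brefl Bdir Bnbhs] _] := EB.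
move=> /BU[B1 BB1 B1V].
have /BU[B2 BB2 B2B1] : nbhs x (xsection B1 x) by apply: (Bnbhs x).1.
have [B3 BB3 B3sub] := Bdir _ _ BB1 BB2.
have B31 : B3 `<=` B1 by move=> p /B3sub[].
have B32 : B3 `<=` B2 by move=> p /B3sub[].
have Bxx B' y : B B' -> B' (y, y) by move=> BB'; apply: (Brefl _ BB').
have link e c y : (forall j, j \in e -> f j `<=` B3) -> linked e (c, y) ->
    exists2 z, B3 (z, c) & B3 (z, y).
  move=> eB [/= <-|[j [z [je fc fy]]]]; first by exists c; exact: Bxx.
  by exists z; exact: (eB j).
exists B3 => // e S eB Ssmall Sx y Sy.
have [c /(link _ _ _ eB)[z1 z1c z1x] /(link _ _ _ eB)[z2 z2c z2y]] := Ssmall _ _ Sx Sy.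
have B1xc : B1 (x, c).
  apply/xsectionP/B2B1/xsectionP.
  by exists z1; [exists x; [exact: Bxx|exact: B32]|exact: B32].
apply/B1V/xsectionP.
by exists z2; [exists c => //; exact: B31|exact: B31].
Qed.

End LinkedSets.

(** * Discrete families and their finite meets *)

Section DiscreteFamilies.
Variable X : topologicalType.
Implicit Types (F G : set (set X)) (D : nat -> set (set X)).

Lemma discrete_family_closure F :
  discrete_family F -> discrete_family (@closure X @` F).
Proof.
move=> dF x; have [V Vx VF] := dF x; exists V° => [|_ _ [A FA <-] [A' FA' <-]].
  exact: nbhs_interior.
have meetsV S : closure S `&` V° !=set0 -> S `&` V !=set0.
  by move=> [y [/[apply]]].
by move=> /meetsV AV /meetsV AV'; rewrite (VF A A').
Qed.

Lemma discrete_family_shrink F (g : set X -> set X) :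
  (forall A, g A `<=` A) -> discrete_family F -> discrete_family (g @` F).
Proof.
move=> gA dF x; have [V Vx VF] := dF x; exists V => // _ _ [A FA <-] [A' FA' <-].
by move=> [y [/gA Ay Vy]] [z [/gA Az Vz]]; rewrite (VF A A') //; [exists y|exists z].
Qed.

Lemma discrete_family_setI F G : discrete_family F -> discrete_family G ->
  discrete_family [set A `&` A' | A in F & A' in G].
Proof.
move=> dF dG x; have [V Vx VF] := dF x; have [W Wx WG] := dG x.
exists (V `&` W); first exact: filterI.
move=> _ _ [A FA [A' GA' <-]] [C FC [C' GC' <-]] [y [[Ay A'y] [Vy Wy]]] [z [[Cz C'z] [Vz Wz]]].
have -> : A = C by apply: VF => //; [exists y|exists z].
by have -> : A' = C' by apply: WG => //; [exists y|exists z].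
Qed.

Definition meets D (s : seq nat) : set (set X) :=
  foldr (fun i F => [set A `&` A' | A in D i & A' in F]) [set setT] s.

Lemma discrete_family_meets D s :
  (forall n, discrete_family (D n)) -> discrete_family (meets D s).
Proof.
move=> dD; elim: s => [|i s IHs] /=; last exact: discrete_family_setI.
by move=> x; exists setT => [|_ _ -> ->]; first exact: filterT.
Qed.

(** The intersection of the members of the first [n] families that contain [K];
it is the whole space when there are none. *)
Definition hull D (K : set X) n : set X :=
  [set x | forall i A, (i < n)%N -> D i A -> K `<=` A -> A x].

Lemma sub_hull D K n : K `<=` hull D K n.
Proof. by move=> x Kx i A _ _; apply. Qed.

Lemma hull_le D K m n : (m <= n)%N -> hull D K n `<=` hull D K m.
Proof. by move=> mn x Hx i A im; apply: Hx; exact: leq_trans mn. Qed.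

Lemma hull_closed D K n : (forall i A, D i A -> closed A) -> closed (hull D K n).
Proof.
move=> clD x clx i A ni DA KA; apply: (clD i A DA); apply: closureS clx => y Hy.
exact: (Hy i).
Qed.

(** A discrete family has at most one member containing the nonempty set [K], so
each family adds at most one factor to the intersection. *)
Lemma hull_meets D K n : (forall n, discrete_family (D n)) -> K !=set0 ->
  exists s, meets D s (hull D K n).
Proof.
move=> dD [x Kx]; elim: n => [|n [s IHs]].
  by exists [::]; apply/seteqP; split=> // y _ i A.
have [[A [DA KA]]|nA] := pselect (exists A, D n A /\ K `<=` A); last first.
  exists s; rewrite (_ : hull D K n.+1 = hull D K n) //.
  apply/seteqP; split=> [|y Hy i A]; first exact: hull_le.
  rewrite ltnS leq_eqVlt => /predU1P[->|]; last exact: Hy.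
  by move=> DA KA; case: nA; exists A.
exists (n :: s); exists A => //; exists (hull D K n) => //.
apply/seteqP; split=> [y [Ay Hy] i A'|y Hy]; last first.
  by split; [exact: (Hy n)|exact: hull_le Hy].
rewrite ltnS leq_eqVlt => /predU1P[->|]; last exact: Hy.
move=> DA' KA'; have [V Vx VD] := dD n x.
rewrite (VD A' A) //; exists x; split; by [exact: KA|exact: KA'|exact: nbhs_singleton].
Qed.

End DiscreteFamilies.

(** * Sequences shrinking to a countably compact set *)

(** A closed set disjoint from [K] misses some [T n], so it contains only
finitely many points of the closure of the sequence.  Hence an infinite set [S]
in this closure accumulates: if it has finitely many points in [K], then
[S `\` K] is infinite, so it is not closed, while sets without accumulation
points are. *)
Lemma ccpt_closure_range (X : topologicalType) (K : set X) (T : nat -> set X)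
    (x : nat -> X) :
  accessible_space X -> closed_countably_compact K ->
  (forall n, closed (T n)) -> (forall m n, (m <= n)%N -> T n `<=` T m) ->
  (forall U, open U -> K `<=` U -> exists n, T n `<=` U) ->
  (forall n, T n (x n)) -> closed_countably_compact (closure (range x)).
Proof.
move=> T1 [clK accK] clT Tdec TU xT.
have T1fin := accessible_finite_set_closed.1 T1.
have prefixfin n : finite_set (x @` `I_n).
  by apply: finite_image; exact: finite_II.
have clrangeT n : closure (range x) `<=` T n `|` x @` `I_n.
  have /closure_id -> : closed (T n `|` x @` `I_n).
    by apply: closedU; [exact: clT|exact: T1fin].
  apply: closureS => _ [m _ <-]; have [mn|nm] := ltnP m n; first by right; exists m.
  by left; exact: Tdec (xT m).
have avoid S : closed S -> K `&` S = set0 -> exists n, T n `&` S = set0.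
  move=> clS KS; have [|y Ky Sy|n TS] := TU (~` S).
  - exact: closed_openC.
  - by have : (K `&` S) y by []; rewrite KS.
  by exists n; apply/seteqP; split=> // y [/TS].
split=> [|S Sx Sinf]; first exact: closed_closure.
have [finSK|infSK] := pselect (finite_set (S `&` K)); last first.
  have [|y accy] := accK _ _ infSK; first by move=> ? [].
  by exists y => V /accy; apply: contra_not; apply: sub_finite_set => z [Vz []].
apply: contrapT => nacc.
have [||n TS] := avoid (S `\` K).
- apply: nonaccumulating_closed => // -[y accy]; apply: nacc; exists y => V /accy.
  by apply: contra_not; apply: sub_finite_set => z [Vz []].
- by apply/seteqP; split=> // z [Kz []].
apply: Sinf; apply: (@sub_finite_set _ _ ((S `&` K) `|` x @` `I_n)).
  move=> y Sy; have [Ky|nKy] := pselect (K y); [by left|right].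
  have [Ty|//] := clrangeT n y (Sx y Sy).
  by have : (T n `&` (S `\` K)) y by []; rewrite TS.
by rewrite finite_setU; split.
Qed.

(** * Passing to the whole space *)

(** The members of the covers of [K] form a countable network at its points. *)
Lemma netbase_ccpt_shrink (X : topologicalType) (f : nat -> set (X * X))
    (E B : set (set (X * X))) (K U : set X) :
  regular_space X -> (forall D, E D -> exists n, f n = D) ->
  netbase (@cs_bar X) E B -> locally_uniform B -> closed_countably_compact K ->
  open U -> K `<=` U -> exists V, [/\ open V, K `<=` V & closure V `<=` U].
Proof.
move=> regX fE EB BU Kc; have [P PP] := linked_covers f.
pose Q m := if unpickle m is Some (e, k) then P K e k else set0.
apply: (@ccpt_trace_network_shrink X K U Q) => // x V Kx Vx.
have [B1 BB1 B1V] := linked_small_sub f EB BU Vx.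
have [|_ [e [eB [Q' Q'K]]]] := @linked_covered X f E B fE EB (fun=> K) B1 BB1.
  by move=> y _ Ky; apply: (ccpt_closure_sub Kc) => _ [n _ <-].
have [_ [|small PK]] := PP K e; first by exists Q'.
have [k _ Px] := PK x Kx.
exists (pickle (e, k)); rewrite /Q pickleK; split=> //.
exact: (B1V e).
Qed.

Theorem theorem4p1 (X : topologicalType) :
  Sigma_space X ->
  (exists E B : set (set (X * X)),
     [/\ netbase (@cs_bar X) E B, countable E & locally_uniform B]) ->
  sigma_space X.
Proof.
move=> [regX T0 [C [_ [Ccover Cccpt [D dD ->] CD]]]] [E [B [EB /countable_enum[f fE] BU]]].
split=> //; have T1 := regular_T0_accessible regX T0.
pose cD n := @closure X @` D n.
have dcD n : discrete_family (cD n) by exact: discrete_family_closure.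
have clcD i A : cD i A -> closed A by move=> [S _ <-]; exact: closed_closure.
have hullU K U : C K -> open U -> K `<=` U -> exists n, hull cD K n `<=` U.
  move=> CK oU KU.
  have [V [oV KV VU]] := netbase_ccpt_shrink regX fE EB BU (Cccpt _ CK) oU KU.
  have [A [[i _ DA] KA AV]] := CD _ _ CK oV KV.
  exists i.+1 => x /(_ i (closure A) (ltnSn i)) Ax; apply: VU.
  apply: (closureS AV); apply: Ax; first by exists A.
  by move=> y /KA; exact: subset_closure.
have [P PP] := linked_covers f.
pose N m := if unpickle m is Some (s, e, k)
  then [set T `&` P T e k | T in meets cD s] else set0.
exists (\bigcup_m N m); split.
  exists N => // m; rewrite /N; case: unpickle => [[[s e] k]|]; last first.
    by move=> x; exists setT => //; exact: filterT.
  apply: (discrete_family_shrink (g := fun T => T `&` P T e k)) => [T x []//|].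
  exact: discrete_family_meets.
move=> U x oU Ux.
have [K CK Kx] : (\bigcup_(K in C) K) x by rewrite Ccover.
have [|B1 BB1 B1U] := linked_small_sub f EB BU (x := x) (V := U).
  by apply: open_nbhs_nbhs.
have [|n [e [eB [Q QT]]]] := @linked_covered X f E B fE EB (hull cD K) B1 BB1.
  move=> y _; apply: (ccpt_closure_range T1 (Cccpt _ CK)).
  - by move=> n; exact: hull_closed.
  - by move=> m n; exact: hull_le.
  - by move=> V; exact: hullU.
have [s Hs] : exists s, meets cD s (hull cD K n) by apply: hull_meets => //; exists x.
have [_ [|small PT]] := PP (hull cD K n) e; first by exists Q.
have [k _ Px] := PT x (@sub_hull _ cD K n x Kx).
exists (hull cD K n `&` P (hull cD K n) e k); split.
- exists (pickle (s, e, k)) => //; rewrite /N pickleK.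
  by exists (hull cD K n).
- by split=> //; exact: sub_hull.
- by move=> y [_]; exact: (B1U e).
Qed.
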